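(* There exists an infinite family of oriented virtual knots with the same $F$-polynomials; that is, there is an infinite set $\mathcal{K}$ of (pairwise distinct) oriented virtual knots such that $F^{n}_{K}(t,\ell)=F^{n}_{K'}(t,\ell)$ for all $K,K'\in\mathcal{K}$ and all integers $n\ge 1$.
   Context: **Virtual knots.** An oriented virtual knot diagram $D$ is a generic immersion of an oriented circle in the plane in which each double point is marked either as a classical crossing (with over/under information) or as a virtual crossing. An oriented virtual knot is an equivalence class of oriented virtual knot diagrams under the (oriented) classical Reidemeister moves and virtual Reidemeister moves. $C(D)$ denotes the set of classical crossings of $D$. An arc of $D$ is an edge between two consecutive classical crossings along the orientation (virtual crossings are ignored). **Sign.** Draw a classical crossing $c$ with both strands pointing upward. Then $\operatorname{sgn}(c)=+1$ if the overstrand runs from bottom-left to top-right, and $\operatorname{sgn}(c)=-1$ if the overstrand runs from bottom-right to top-left. **Labeling and index.** Every oriented virtual knot diagram $D$ admits an integer labeling of its arcs (a Cheng coloring) such that at each classical crossing of either sign, drawn with both strands pointing upward, if the incoming bottom-left arc has label $a$ and the incoming bottom-right arc has label $b$, then the outgoing top-left arc has label $b+1$ and the outgoing top-right arc has label $a-1$. Labels do not change when passing through virtual crossings. One such labeling is $\lambda(\alpha)=\sum_{c\in O(\alpha)}\operatorname{sgn}(c)$, where $O(\alpha)$ is the set of classical crossings first met as overcrossings on traveling along the orientation starting at the arc $\alpha$. The index value of a classical crossing $c$ is $\operatorname{Ind}(c)=\operatorname{sgn}(c)(a-b-1)$, where, with $c$ drawn so that both strands point upward, $a$ is the label of the incoming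 bottom-left arc at $c$ and $b$ is the label of the incoming bottom-right arc at $c$. **Writhes and dwrithes.** For $n\in\mathbb{Z}\setminus\{0\}$, the $n$-th writhe $J_n(D)$ is the number of positive crossings of $D$ with index value $n$ minus the number of negative crossings of $D$ with index value $n$. For an integer $n\ge 1$, the $n$-th dwrithe is $\nabla J_n(D)=J_n(D)-J_{-n}(D)$. **Smoothing against orientation.** For $c\in C(D)$, drawn with both strands pointing upward, $D_c$ is the diagram obtained by removing $c$ and joining the two top (outgoing) ends to each other by an arc and the two bottom (incoming) ends to each other by an arc. The result is again a virtual knot diagram, with one less classical crossing. It is oriented as follows: the part of $D$ traversed after passing $c$ on the overstrand until the return to $c$ on the understrand keeps its orientation, and the other part (from $c$ on the understrand until the return to $c$ on the overstrand) has its orientation reversed. Over/under information at the other classical crossings is unchanged. Signs, labels and index values used for $\nabla J_n(D_c)$ are computed in the oriented diagram $D_c$. **$F$-polynomials.** For an integer $n\ge1$, the $n$-th $F$-polynomial of an oriented virtual knot diagram $D$ is $$F_{D}^{n}(t,\ell)=\sum_{c\in C(D)}\operatorname{sgn}(c)\,t^{\operatorname{Ind}(c)}\ell^{\nabla J_n(D_c)}-\sum_{c\in T_n(D)}\operatorname{sgn}(c)\,\ell^{\nabla J_n(D_c)}-\sum_{c\in C(D)\setminus T_n(D)}\operatorname{sgn}(c)\,\ell^{\nabla J_n(D)},$$ where $T_n(D)=\{c\in C(D): |\nabla J_n(D_c)|=|\nabla J_n(D)|\}$. It is a known result that $F^n_D(t,\ell)$ depends only on the oriented virtual knot $K$ represented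 by $D$, and it is denoted $F^n_K(t,\ell)$. The $F$-polynomials of $K$ are the sequence $\{F^n_K(t,\ell)\}_{n=1}^{\infty}$. *)

(* Defs.v *)
From Stdlib Require Export Relation_Operators.
From mathcomp Require Export all_boot all_order all_algebra.
From mathcomp Require Export classical_sets cardinality.
Set Implicit Arguments.
Unset Strict Implicit.
Unset Printing Implicit Defensive.
Import GRing.Theory.

(* A generic immersion of an oriented circle in the plane is recorded, up to
   orientation-preserving isotopy of the plane, by the word of the double points
   met along the curve.  Draw a double point with both strands pointing upward:
   the passage (c, true) is the strand through c that comes in at the bottom
   left (and leaves at the top right), and (c, false) is the strand that comes
   in at the bottom right. *)
Definition passage : Type := (nat * bool)%type.

Definition other (p : passage) : passage := (p.1, ~~ p.2).

(* [Positive]: the strand from bottom left to top right is the overstrand. *)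
Inductive crossing_kind := Virtual | Positive | Negative.

Definition is_classical (k : crossing_kind) : bool :=
  if k is Virtual then false else true.

Definition kind_sign (k : crossing_kind) : int :=
  match k with Virtual => 0 | Positive => 1 | Negative => -1 end%R.

Definition switch (k : crossing_kind) : crossing_kind :=
  match k with
  | Virtual => Virtual
  | Positive => Negative
  | Negative => Positive
  end.

(* Only meaningful for a classical [k]: the strand on side [b] is the
   overstrand. *)
Definition over_side (k : crossing_kind) (b : bool) : bool :=
  match k with Virtual => false | Positive => b | Negative => ~~ b end.

(* The word is read from a base point, on an edge adjacent to the unbounded
   region of the plane; [outer_left] tells whether that region lies on the left
   of the curve at the base point.  [kind] is irrelevant at labels that do not
   occur in the word. *)
Record prediagram := Prediagram {
  word : seq passage;
  kind : nat -> crossing_kind;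
  outer_left : bool
}.

Definition double_points_ok (w : seq passage) : bool :=
  uniq w && all (fun p => other p \in w) w.

(* The word determines a cellular immersion of the circle in a closed oriented
   surface.  An edge is named by the passage it leaves (cyclically), and a dart
   (p, d) is that edge walked along the orientation if d = true and against it
   if d = false.  [face_step] turns left at each double point, so that its
   orbits are the boundaries of the faces, kept on the left of the walk. *)
Definition dart : Type := (passage * bool)%type.

Definition face_step (w : seq passage) (x : dart) : dart :=
  let p := x.1 in
  if x.2 then
    let q := next w p in
    if q.2 then (other q, true) else (prev w (other q), false)
  else
    if p.2 then (prev w (other p), false) else (other p, true).

Definition darts (w : seq passage) : seq dart :=
  [seq (p, true) | p <- w] ++ [seq (p, false) | p <- w].

Definition face_orbit (w : seq passage) (x : dart) : seq dart :=
  traject (face_step w) x (size (darts w)).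

Definition faces (w : seq passage) : seq (seq dart) :=
  undup [seq [seq y <- darts w | y \in face_orbit w x] | x <- darts w].

(* Euler's formula F = V + 2 (with E = 2 V); the circle without double points
   is listed apart because it has no vertex. *)
Definition planar (w : seq passage) : bool :=
  nilp w || (size (faces w) == (size w)./2 + 2).

Definition valid (D : prediagram) : bool :=
  double_points_ok (word D) && planar (word D).

Record diagram := Diagram {
  prediagram_of :> prediagram;
  diagram_valid : valid prediagram_of
}.

(* In the Reidemeister moves, consecutive passages of the word are joined by an
   edge that does not carry the base point, so that the unbounded region is
   never the monogon, bigon or triangle that takes part in the move. *)

Definition R2_kinds (kx ky : crossing_kind) : bool :=
  match kx, ky with
  | Virtual, Virtual | Positive, Negative | Negative, Positive => true
  | _, _ => false
  end.

Definition along (o : bool) (p q : passage) : seq passage :=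
  if o then [:: p; q] else [:: q; p].

(* A triangle with corners a, b, c is walked anticlockwise along strand 1 from
   c to a, strand 2 from a to b, and strand 3 from b to c; oi tells whether the
   walk follows the orientation of strand i.  Since the walk turns left at each
   corner, the oi determine the sides of all the passages.  The bits di are the
   order in which each strand meets its two corners: di = oi on one side of the
   move and di = ~~ oi on the other side. *)
Definition strand1 (o1 o2 o3 : bool) (a b c : nat) (d : bool) :=
  along d (c, o1 != o3) (a, o1 == o2).
Definition strand2 (o1 o2 o3 : bool) (a b c : nat) (d : bool) :=
  along d (a, o2 != o1) (b, o2 == o3).
Definition strand3 (o1 o2 o3 : bool) (a b c : nat) (d : bool) :=
  along d (b, o3 != o2) (c, o3 == o1).

(* Three virtual crossings, or two virtual crossings and a classical one, or
   three classical crossings such that the relation "passes over" between the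
   three strands is not cyclic. *)
Definition R3_kinds (o1 o2 o3 : bool) (ka kb kc : crossing_kind) : bool :=
  let over12 := over_side ka (o1 == o2) in
  let over23 := over_side kb (o2 == o3) in
  let over31 := over_side kc (o3 == o1) in
  match is_classical ka + is_classical kb + is_classical kc with
  | 0 | 1 => true
  | 3 => ~~ ((over12 == over23) && (over23 == over31))
  | _ => false
  end.

Inductive move : prediagram -> prediagram -> Prop :=
| Relabel w k s (f : nat -> nat) k' :
    {in [seq p.1 | p <- w] &, injective f} ->
    {in [seq p.1 | p <- w], forall c, k' (f c) = k c} ->
    move (Prediagram w k s) (Prediagram [seq (f p.1, p.2) | p <- w] k' s)
(* The new base edge lies on the boundary of the same, unbounded, region. *)
| Rebase p u q v k s s' :
    (q, s) \in face_orbit (rcons u p ++ rcons v q) (p, s') ->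
    move (Prediagram (rcons u p ++ rcons v q) k s)
         (Prediagram (rcons v q ++ rcons u p) k s')
| Reidemeister1 u v k s x b :
    move (Prediagram (u ++ v) k s)
         (Prediagram (u ++ [:: (x, b); (x, ~~ b)] ++ v) k s)
(* The second strand meets x and y in the order x, y if d, and y, x otherwise. *)
| Reidemeister2 u v w k s x y b d :
    R2_kinds (k x) (k y) ->
    move (Prediagram (u ++ v ++ w) k s)
         (Prediagram (u ++ [:: (x, b); (y, ~~ b)] ++ v
                        ++ along d (x, ~~ b) (y, b) ++ w) k s)
| Reidemeister3 u v w z k s o1 o2 o3 a b c :
    R3_kinds o1 o2 o3 (k a) (k b) (k c) ->
    let S1 := strand1 o1 o2 o3 a b c in
    let S2 := strand2 o1 o2 o3 a b c in
    let S3 := strand3 o1 o2 o3 a b c in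
    move
      (Prediagram (u ++ S1 o1 ++ v ++ S2 o2 ++ w ++ S3 o3 ++ z) k s)
      (Prediagram (u ++ S1 (~~ o1) ++ v ++ S2 (~~ o2) ++ w ++ S3 (~~ o3) ++ z)
         k s)
| Reidemeister3' u v w z k s o1 o2 o3 a b c :
    R3_kinds o1 o2 o3 (k a) (k b) (k c) ->
    let S1 := strand1 o1 o2 o3 a b c in
    let S2 := strand2 o1 o2 o3 a b c in
    let S3 := strand3 o1 o2 o3 a b c in
    move
      (Prediagram (u ++ S1 o1 ++ v ++ S3 o3 ++ w ++ S2 o2 ++ z) k s)
      (Prediagram (u ++ S1 (~~ o1) ++ v ++ S3 (~~ o3) ++ w ++ S2 (~~ o2) ++ z)
         k s).

Definition virtually_equivalent : diagram -> diagram -> Prop :=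
  clos_refl_sym_trans diagram (fun D D' => move D D').

Record virtual_knot := VirtualKnot {
  diagrams_of : set diagram;
  virtual_knot_class : exists D, diagrams_of = virtually_equivalent D
}.

Section Invariants.
Local Open Scope ring_scope.
Implicit Types (D : prediagram) (p : passage) (c : nat).

Definition sgn D c : int := kind_sign (kind D c).

Definition crossings D : seq nat :=
  [seq p.1 | p <- word D & p.2 && is_classical (kind D p.1)].

Definition is_over D p : bool := over_side (kind D p.1) p.2.

(* The word travelled along when starting on the arc that comes in at p. *)
Definition word_from D p : seq passage := rot (index p (word D)) (word D).

Definition first_met_over D p : seq nat :=
  [seq q.1 | q <- word_from D p &
     [&& is_classical (kind D q.1), is_over D q &
         (index q (word_from D p) < index (other q) (word_from D p))%N]].

Definition label D p : int := \sum_(c <- first_met_over D p) sgn D c.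

Definition Ind D c : int :=
  sgn D c * (label D (c, true) - label D (c, false) - 1).

Definition writhe (n : int) D : int :=
  \sum_(c <- crossings D | Ind D c == n) sgn D c.

Definition dwrithe (n : nat) D : int := writhe n%:Z D - writhe (- n%:Z) D.

(* Write the word as u, first passage at c, v, second passage at c, z.  If the
   first passage is the overstrand then v keeps its orientation and the part
   z u, which contains the base point, is reversed; otherwise v is reversed.
   A double point d between v and z u has exactly one of its strands reversed:
   turning it upright again exchanges its bottom left and bottom right strands,
   and this changes the sign of d if d is classical. *)
Definition smooth c D : prediagram :=
  let w := word D in
  let at_c (p : passage) := p.1 == c in
  let i := find at_c w in
  let u := take i w in
  let r := drop i.+1 w in
  let j := find at_c r in
  let v := take j r in
  let z := drop j.+1 r in
  let reverse_outside := is_over D (nth (c, true) w i) in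
  let mixed (d : nat) := ((d, true) \in v) != ((d, false) \in v) in
  Prediagram
    [seq (p.1, p.2 (+) mixed p.1) |
       p <- if reverse_outside then rev z ++ v ++ rev u else u ++ rev v ++ z]
    (fun d => if mixed d then switch (kind D d) else kind D d)
    (outer_left D (+) reverse_outside).

(* Laurent polynomials in t and l with integer coefficients, inside the field
   of rational functions. *)
Definition ratfun : fieldType := {fraction {poly {poly int}}}.
Definition var_t : ratfun := tofrac ('X : {poly {poly int}}).
Definition var_l : ratfun := tofrac (('X : {poly int})%:P).

Definition in_T (n : nat) D c : bool :=
  `|dwrithe n (smooth c D)| == `|dwrithe n D|.

Definition F_diagram (n : nat) D : ratfun :=
  \sum_(c <- crossings D)
     (sgn D c)%:~R * var_t ^ Ind D c * var_l ^ dwrithe n (smooth c D)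
  - \sum_(c <- crossings D | in_T n D c)
     (sgn D c)%:~R * var_l ^ dwrithe n (smooth c D)
  - \sum_(c <- crossings D | ~~ in_T n D c)
     (sgn D c)%:~R * var_l ^ dwrithe n D.

(* P n, for n >= 1, is the n-th F-polynomial of K, read on a diagram of K; it is
   known that it does not depend on the diagram. *)
Definition F_polynomials (K : virtual_knot) (P : nat -> ratfun) : Prop :=
  exists2 D : diagram, diagrams_of K D & forall n, (0 < n)%N -> F_diagram n D = P n.

End Invariants.

(* Main.v *)
Require Import Defs.
From mathcomp Require Import zify ring.
Set Implicit Arguments.
Unset Strict Implicit.
Unset Printing Implicit Defensive.
Import GRing.Theory.

(** All the F-polynomials of a classical knot vanish: its indices are 0, the
    smoothings of a diagram without virtual crossings have no virtual
    crossings either, so that all dwrithes are 0, every crossing lies in T_n,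
    and the first two sums in the F-polynomial cancel. Hence it suffices to
    find infinitely many classical knots that stay distinct up to virtual
    equivalence. The knots below are the torus knots T(2,p) for the odd primes
    p.

    For these knots the vanishing is a direct computation with chords. The
    index of a crossing compares how often, counted with signs, each of the
    two arcs between its passages runs over the other one ([label_chord],
    [Ind_eq0]). In the standard diagram of T(2,n), n odd, each chord is
    crossed in parallel by all the others, and overpasses alternate with
    underpasses, so both arcs have (n - 1)/2 overpasses ([torus_Ind]).
    Smoothing such a chord against the orientation gives a curve that retraces
    its first half backwards; its chords are nested, and a chord that crosses
    no other chord has index 0 ([smooth_parallel]).

    The knots are distinguished by Fox colourings with values in the field
    with p elements. A colouring ignores the virtual crossings, and each
    Reidemeister move replaces a small tangle by another one which admits the
    same colours at its ends ([move_colorable]). Colours of consecutive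
    overstrands of T(2,n) form an arithmetic progression of period n, so that
    T(2,p) has a nonconstant colouring modulo p ([torus_colorable]), and
    T(2,q) has none if q is prime to p ([torus_not_colorable]).

    That the words of the T(2,n) are planar is checked by Euler's formula, on
    an explicit numbering of the n + 2 faces ([torus_planar]). *)

Local Open Scope ring_scope.

(** * Fox colourings *)

(** A colouring is recorded by the colours y of the overstrands at the
    classical crossings. Walking along w from an arc of colour a then forces
    the colours of all further arcs, and b is the colour of the last one. *)
Fixpoint carries (R : comNzRingType) (k : nat -> crossing_kind) (y : nat -> R)
    (w : seq passage) (a b : R) : Prop :=
  if w is p :: w' then
    if is_classical (k p.1) then
      if over_side (k p.1) p.2 then y p.1 = a /\ carries k y w' a b
      else carries k y w' (2 * y p.1 - a) b
    else carries k y w' a b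
  else a = b.

Definition monochromatic (R : comNzRingType) (k : nat -> crossing_kind)
    (y : nat -> R) (w : seq passage) (a : R) : Prop :=
  {in w, forall p, is_classical (k p.1) -> y p.1 = a}.

Definition colorable (R : comNzRingType) (D : prediagram) : Prop :=
  exists (y : nat -> R) (a : R),
    carries (kind D) y (word D) a a /\
    ~ monochromatic (kind D) y (word D) a.

Lemma carries_cat (R : comNzRingType) k (y : nat -> R) w1 w2 a b :
  carries k y (w1 ++ w2) a b <->
  exists2 m, carries k y w1 a m & carries k y w2 m b.
Proof.
elim: w1 a => [|p w1 IH] a /=.
  by split=> [h|[m -> //]]; exists a.
case: ifP => _; last exact: IH.
case: ifP => _; last exact: IH.
rewrite IH; split=> [[-> [m h1 h2]]|[m [-> h1] h2]]; first by exists m.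
by split=> //; exists m.
Qed.

Lemma carries_relabel (R : comNzRingType) k k' (y y' : nat -> R) f w a b :
    {in w, forall p, k' (f p.1) = k p.1 /\ y' (f p.1) = y p.1} ->
  carries k' y' [seq (f p.1, p.2) | p <- w] a b <-> carries k y w a b.
Proof.
elim: w a => [|p w IH] a h //=.
have [-> ->] : k' (f p.1) = k p.1 /\ y' (f p.1) = y p.1.
  by apply: h; rewrite mem_head.
have {}IH c : carries k' y' [seq (f p.1, p.2) | p <- w] c b <->
              carries k y w c b.
  by apply: IH => q qw; apply: h; rewrite inE qw orbT.
case: ifP => _; last exact: IH.
case: ifP => _; last exact: IH.
by rewrite IH.
Qed.

Lemma eq_carries (R : comNzRingType) k (y y' : nat -> R) w a b :
    {in w, forall p, y' p.1 = y p.1} ->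
  carries k y w a b -> carries k y' w a b.
Proof.
move=> h; have := @carries_relabel R k k y y' id w a b.
rewrite map_id_in => [|[]//] H; apply H => p pw.
by split; last exact: h.
Qed.

Lemma monochromatic_cat (R : comNzRingType) k (y : nat -> R) w1 w2 a :
  monochromatic k y (w1 ++ w2) a <->
  monochromatic k y w1 a /\ monochromatic k y w2 a.
Proof.
split=> [h|[h1 h2] p].
  by split=> p pw; apply: h; rewrite mem_cat pw ?orbT.
by rewrite mem_cat => /orP[/h1|/h2].
Qed.

Lemma monochromatic_carries (R : comNzRingType) k (y : nat -> R) w a b :
  monochromatic k y w a -> carries k y w a b -> b = a.
Proof.
elim: w => [|p w IH] //= /(monochromatic_cat _ _ [:: p])[hp /IH{}IH].
case: ifP => [kp|_]; last exact: IH.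
have -> := hp p (mem_head _ _) kp.
by case: ifP => _; [case|have -> : 2 * a - a = a by ring].
Qed.

(** If all the overstrands had the colour b of the new base arc, walking along
    v would never change the colour, and the old base arc would also have the
    colour b. *)
Lemma colorable_rot (R : comNzRingType) u v k s s' :
  colorable R (Prediagram (u ++ v) k s) ->
  colorable R (Prediagram (v ++ u) k s').
Proof.
move=> [y [a /= [/carries_cat[b ub vb] nmono]]]; exists y, b; split=> /=.
  by apply/carries_cat; exists a.
move=> /monochromatic_cat[vm um]; apply: nmono; apply/monochromatic_cat.
by have ab := monochromatic_carries vm vb; rewrite ab.
Qed.

Lemma colorable_relabel (R : comNzRingType) w k s f k' s' :
    {in [seq p.1 | p <- w] &, injective f} ->
    {in [seq p.1 | p <- w], forall c, k' (f c) = k c} ->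
  colorable R (Prediagram w k s) <->
  colorable R (Prediagram [seq (f p.1, p.2) | p <- w] k' s').
Proof.
move=> finj fk.
have fk1 p : p \in w -> k' (f p.1) = k p.1.
  by move=> pw; apply: fk; apply: map_f.
have step (y y' : nat -> R) a : {in w, forall p, y' (f p.1) = y p.1} ->
    (carries k y w a a /\ ~ monochromatic k y w a) <->
    (carries k' y' [seq (f p.1, p.2) | p <- w] a a /\
      ~ monochromatic k' y' [seq (f p.1, p.2) | p <- w] a).
  move=> yy'; rewrite carries_relabel => [|p pw]; last first.
    by rewrite fk1 // yy'.
  suff -> : monochromatic k' y' [seq (f p.1, p.2) | p <- w] a <->
    monochromatic k y w a by [].
  split=> [m p pw kp|m _ /mapP[p pw ->] /=]; last first.
    by rewrite fk1 // yy' //; exact: m.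
  by rewrite -yy' //; apply: (m (f p.1, p.2)); rewrite ?fk1 // map_f.
split=> [[y [a /= H]]|[y' [a /= H]]]; last first.
  by exists (y' \o f), a; apply/(step (y' \o f) y').
set L := [seq p.1 | p <- w] in finj fk.
exists (fun d => y (nth 0%N L (index d (map f L)))), a.
apply/(step y) => // p pw.
have pL : p.1 \in L by exact: map_f.
by rewrite nth_index_map.
Qed.

(** * Replacing tangles *)

(** Three strands are enough for all the Reidemeister moves; the simpler moves
    have empty strands. *)
Definition tangle : Type := (seq passage * seq passage * seq passage)%type.

Definition tangle_carries (R : comNzRingType) k (y : nat -> R) (T : tangle)
    (a b : R * R * R) : Prop :=
  [/\ carries k y T.1.1 a.1.1 b.1.1, carries k y T.1.2 a.1.2 b.1.2
    & carries k y T.2 a.2 b.2].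

Definition tangle_word (T : tangle) : seq passage := T.1.1 ++ T.1.2 ++ T.2.

(** The last clause is what makes monochromatic colourings correspond to each
    other: if the recolouring is constant, then so was the colouring that it
    comes from. *)
Definition recolorable (R : comNzRingType) k (X : seq nat) (T T' : tangle)
    (y : nat -> R) (a b : R * R * R) : Prop :=
  exists y' : nat -> R,
    [/\ {in [predC X], y' =1 y}, tangle_carries k y' T' a b
      & forall e, a = (e, e, e) -> b = (e, e, e) ->
          monochromatic k y' (tangle_word T') e ->
          monochromatic k y (tangle_word T) e].

Definition refines (R : comNzRingType) k (X : seq nat) (T T' : tangle) : Prop :=
  forall (y : nat -> R) a b,
    tangle_carries k y T a b -> recolorable k X T T' y a b.

Definition plug (u v w z : seq passage) (T : tangle) : seq passage :=
  u ++ T.1.1 ++ v ++ T.1.2 ++ w ++ T.2 ++ z.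

(** The strands of both tangles have the same colours at their ends, so that
    the outer colouring extends. If the new colouring is constant, then all
    these ends have the colour of the base arc, and the old colouring is
    constant inside the tangle as well. *)
Lemma colorable_refines (R : comNzRingType) k s X u v w z T T' :
    {in u ++ v ++ w ++ z, forall p, p.1 \notin X} ->
    refines R k X T T' ->
  colorable R (Prediagram (plug u v w z T) k s) ->
  colorable R (Prediagram (plug u v w z T') k s).
Proof.
case: T T' => [[s1 s2] s3] [[t1 t2] t3] notX ext [y [a []]].
rewrite /plug /=.
move=> /carries_cat[a1 uc /carries_cat[b1 s1c /carries_cat[a2 vc]]].
move=> /carries_cat[b2 s2c /carries_cat[a3 wc /carries_cat[b3 s3c zc]]] nmono.
have [] := ext y (a1, a2, a3) (b1, b2, b3); first by split.
move=> y' [yy' [/= t1c t2c t3c] back].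
have same r : {subset r <= u ++ v ++ w ++ z} ->
    {in r, forall p, y' p.1 = y p.1}.
  by move=> sub p pr; apply: yy'; apply: notX; exact: sub.
have [us vs ws zs] : [/\ {in u, forall p, y' p.1 = y p.1},
    {in v, forall p, y' p.1 = y p.1}, {in w, forall p, y' p.1 = y p.1}
    & {in z, forall p, y' p.1 = y p.1}].
  by split; apply: same => p pr; rewrite !mem_cat pr ?orbT.
exists y', a; rewrite /plug /=; split.
  do 6! [apply/carries_cat; eexists; first by [eassumption |
    apply: eq_carries; last by eassumption; assumption]].
  by apply: eq_carries; last by eassumption.
move=> /monochromatic_cat[um /monochromatic_cat[t1m /monochromatic_cat[vm]]].
move=> /monochromatic_cat[t2m /monochromatic_cat[wm]].
move=> /monochromatic_cat[t3m zm]; apply: nmono.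
have mono r : {in r, forall p, y' p.1 = y p.1} ->
    monochromatic k y' r a -> monochromatic k y r a.
  by move=> e m p pr kp; rewrite -e //; apply: m.
have {}um := mono u us um; have {}vm := mono v vs vm.
have {}wm := mono w ws wm; have {}zm := mono z zs zm.
have e := monochromatic_carries um uc; rewrite {}e in t1c back.
have e := monochromatic_carries t1m t1c; rewrite {}e in vc back.
have e := monochromatic_carries vm vc; rewrite {}e in t2c back.
have e := monochromatic_carries t2m t2c; rewrite {}e in wc back.
have e := monochromatic_carries wm wc; rewrite {}e in t3c back.
have e := monochromatic_carries t3m t3c; rewrite {}e in zc back.
have := back a erefl erefl; rewrite /tangle_word /= !monochromatic_cat.
by move=> []// ? [? ?]; do !split.
Qed.

Definition twist x b : tangle := ([:: (x, b); (x, ~~ b)], [::], [::]).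
Definition clasp x y b d : tangle :=
  ([:: (x, b); (y, ~~ b)], along d (x, ~~ b) (y, b), [::]).
Definition triangle o1 o2 o3 a b c d1 d2 d3 : tangle :=
  (strand1 o1 o2 o3 a b c d1, strand2 o1 o2 o3 a b c d2,
   strand3 o1 o2 o3 a b c d3).

Lemma over_sideN k b : is_classical k -> over_side k (~~ b) = ~~ over_side k b.
Proof. by case: k. Qed.

Lemma monochromatic_cons (R : comNzRingType) k (y : nat -> R) p w a :
  monochromatic k y (p :: w) a <->
  (is_classical (k p.1) -> y p.1 = a) /\ monochromatic k y w a.
Proof.
rewrite (monochromatic_cat _ _ [:: p]); split=> -[h1 h2]; split=> //.
  by apply: h1; rewrite mem_head.
by move=> q; rewrite inE => /eqP ->.
Qed.

Lemma monochromatic_nil (R : comNzRingType) k (y : nat -> R) a :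
  monochromatic k y [::] a <-> True.
Proof. by split. Qed.

Lemma reflection_fixed (R : comNzRingType) (c a : R) : c = 2 * c - a -> c = a.
Proof. by move=> h; rewrite -[a]addr0 -(subrr c) {2}h; ring. Qed.

Lemma reflection_idem (R : comNzRingType) (a : R) : 2 * a - a = a.
Proof. by ring. Qed.

(** * Invariance under the moves *)

(** The reflection at an overstrand fixes the colour of that strand. *)
Lemma refines_twist (R : comNzRingType) k x b :
  refines R k [:: x] (twist x b) ([::], [::], [::]) /\
  refines R k [:: x] ([::], [::], [::]) (twist x b).
Proof.
split=> y [[a1 a2] a3] [[b1 b2] b3] [/=] => [+ -> ->|-> -> ->].
  rewrite /recolorable /tangle_carries /tangle_word /=.
  case kx: (is_classical (k x)); last first.
    move=> <-; exists y; split=> // e _ _ _.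
    by rewrite !monochromatic_cons /= kx.
  rewrite over_sideN //; case: over_side => /= -[].
    move=> ya <-.
    exists y; split=> //; first by split=> //; rewrite ya reflection_idem.
    by move=> e [<- _ _] _ _; rewrite !monochromatic_cons.
  move=> /reflection_fixed ya <-.
  exists y; split=> //; first by split=> //; rewrite ya reflection_idem.
  by move=> e [<- _ _] _ _; rewrite !monochromatic_cons.
exists (fun d => if d == x then b1 else y d); split=> //.
  by move=> d; rewrite !inE => /negPf ->.
split=> //=; case kx: (is_classical (k x)) => //; rewrite over_sideN // eqxx.
by case: over_side => /=; rewrite reflection_idem.
Qed.

(** Passing under two strands of the same colour applies a reflection
    twice. *)
Lemma refines_clasp (R : comNzRingType) k x y b d : R2_kinds (k x) (k y) ->
  refines R k [:: x; y] (clasp x y b d) ([::], [::], [::]) /\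
  refines R k [:: x; y] ([::], [::], [::]) (clasp x y b d).
Proof.
move=> kxy.
have key : (~~ is_classical (k x) /\ ~~ is_classical (k y)) \/
    exists o, [/\ is_classical (k x), is_classical (k y),
      over_side (k x) b = o & over_side (k y) b = ~~ o].
  case: (k x) (k y) kxy => [] [] // _; first by left.
    by right; exists b.
  by right; exists (~~ b); rewrite /= negbK.
case: key => [[/negPf kx /negPf ky]|[o [kx ky ox oy]]]; split=> c.
- move=> [[a1 a2] a3] [[b1 b2] b3] H; exists c; split=> //.
    by case: d H => -[] /=; rewrite !(kx, ky) => ? ? ?.
  by move=> e _ _ _; case: d H => _; rewrite !monochromatic_cons /= kx ky.
- move=> [[a1 a2] a3] [[b1 b2] b3] [/= -> -> ->]; exists c; split=> //.
  by split=> //=; case: d => /=; rewrite kx ky.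
- move=> [[a1 a2] a3] [[b1 b2] b3] [].
  case: d; rewrite /= !(kx, ky) !(over_sideN _ kx, over_sideN _ ky)
    !(ox, oy) /=;
  case: o {ox oy} => /= [[xa [ya <-]] <- ->|<- [xa [ya <-]] ->];
  exists c; split=> //; try (by split=> //=; rewrite xa ya; ring);
  by move=> e [? ? ?] _ _; rewrite !monochromatic_cons /= xa ya.
- move=> [[a1 a2] a3] [[b1 b2] b3] [/= -> -> ->].
  exists (fun e => if e \in [:: x; y] then if o then b1 else b2 else c e).
  split=> //; first by move=> e; rewrite inE => /negPf ->.
  case: d; split; rewrite //= !(kx, ky) !(over_sideN _ kx, over_sideN _ ky);
  rewrite !(ox, oy) !inE !eqxx ?orbT; case: o {ox oy} => //=; ring.
Qed.

(** In the third move each strand meets its two corners in the other order. In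
    the order of the following lemmas: a strand with a virtual corner, the top
    strand, the middle strand, and the bottom strand, for which p is the
    corner with the top strand. *)
Lemma along_virtual (R : comNzRingType) k (y : nat -> R) d p q a b :
    (is_classical (k p.1) + is_classical (k q.1) <= 1)%N ->
  carries k y (along d p q) a b -> carries k y (along (~~ d) p q) a b.
Proof.
by case: d => /=; case: is_classical; case: is_classical => //=;
  case: over_side.
Qed.

Lemma along_over_over (R : comNzRingType) k (y y' : nat -> R) d p q a b :
    is_classical (k p.1) -> is_classical (k q.1) ->
    over_side (k p.1) p.2 -> over_side (k q.1) q.2 ->
    y' p.1 = y p.1 -> y' q.1 = y q.1 ->
  carries k y (along d p q) a b -> carries k y' (along (~~ d) p q) a b.
Proof.
move=> kp kq op oq yp yq.
by case: d; rewrite /= kp kq op oq yp yq => -[-> [-> ->]].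
Qed.

Lemma along_over_under (R : comNzRingType) k (y y' : nat -> R) d p q a b :
    is_classical (k p.1) -> is_classical (k q.1) ->
    over_side (k p.1) p.2 -> ~~ over_side (k q.1) q.2 ->
    y' p.1 = 2 * y q.1 - y p.1 -> y' q.1 = y q.1 ->
  carries k y (along d p q) a b -> carries k y' (along (~~ d) p q) a b.
Proof.
move=> kp kq op /negPf oq yp yq; case: d; rewrite /= kp kq op oq yp yq.
  by move=> [-> <-].
by move=> [-> <-]; split; ring.
Qed.

Lemma along_under_under (R : comNzRingType) k (y y' : nat -> R) d p q a b :
    is_classical (k p.1) -> is_classical (k q.1) ->
    ~~ over_side (k p.1) p.2 -> ~~ over_side (k q.1) q.2 ->
    y' p.1 = y p.1 -> y' q.1 = 2 * y p.1 - y q.1 ->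
  carries k y (along d p q) a b -> carries k y' (along (~~ d) p q) a b.
Proof.
move=> kp kq /negPf op /negPf oq yp yq.
by case: d; rewrite /= kp kq op oq yp yq => <-; ring.
Qed.

Lemma monochromatic_along (R : comNzRingType) k (y : nat -> R) d p q e :
  monochromatic k y (along d p q) e <-> monochromatic k y [:: p; q] e.
Proof. by case: d => //=; rewrite !monochromatic_cons; tauto. Qed.

Lemma along_over_eq (R : comNzRingType) k (y : nat -> R) d p q a b :
    is_classical (k p.1) -> is_classical (k q.1) ->
    over_side (k p.1) p.2 -> over_side (k q.1) q.2 ->
  carries k y (along d p q) a b -> y p.1 = y q.1.
Proof.
by move=> kp kq op oq; case: d => /=; rewrite kp kq op oq => -[-> [->]].
Qed.

Lemma along_sym (R : comNzRingType) k (y y' : nat -> R) p q :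
    (forall d a b, carries k y (along d q p) a b ->
       carries k y' (along (~~ d) q p) a b) ->
  forall d a b, carries k y (along d p q) a b ->
    carries k y' (along (~~ d) p q) a b.
Proof. by move=> h [] a b; [apply: (h false)|apply: (h true)]. Qed.

(** Conjugating the reflection at the middle strand by the reflection at the
    top strand gives the reflection at the image of the middle strand. *)
Lemma refines_triangle (R : comNzRingType) k o1 o2 o3 a b c d1 d2 d3 :
    a != b -> b != c -> c != a ->
    R3_kinds o1 o2 o3 (k a) (k b) (k c) ->
  refines R k [:: a; b; c] (triangle o1 o2 o3 a b c d1 d2 d3)
    (triangle o1 o2 o3 a b c (~~ d1) (~~ d2) (~~ d3)).
Proof.
move=> ab bc ca; rewrite /R3_kinds /triangle /strand1 /strand2 /strand3.
(* The two strands that meet at a corner pass it on opposite sides, so that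
   three bits describe all the sides. *)
rewrite (eq_sym o1 o3) (eq_sym o2 o1) (eq_sym o3 o2) /=.
move: (o1 == o2) (o2 == o3) (o3 == o1) => {o1 o2 o3} s12 s23 s31 K.
set T := (_, _, _); set T' := (_, _, along (~~ d3) _ _).
move=> y [[a1 a2] a3] [[b1 b2] b3] [/= H1 H2 H3].
have mono (y' : nat -> R) f1 f2 f3 e :
    monochromatic k y' (tangle_word (along f1 (c, ~~ s31) (a, s12),
      along f2 (a, ~~ s12) (b, s23), along f3 (b, ~~ s23) (c, s31))) e <->
    [/\ is_classical (k a) -> y' a = e, is_classical (k b) -> y' b = e
      & is_classical (k c) -> y' c = e].
  rewrite !monochromatic_cat !monochromatic_along !monochromatic_cons
    monochromatic_nil /=.
  by split=> [?|[]]; [split|]; tauto.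
have [all3|few] := boolP [&& is_classical (k a), is_classical (k b)
                           & is_classical (k c)]; last first.
  have [kca kab kbc] : [/\ (is_classical (k c) + is_classical (k a) <= 1)%N,
     (is_classical (k a) + is_classical (k b) <= 1)%N
     & (is_classical (k b) + is_classical (k c) <= 1)%N].
   by move: few K; case: is_classical; case: is_classical; case: is_classical.
  exists y; split=> //; last by move=> e _ _; rewrite !mono.
  by split; apply: along_virtual.
have /and3P[ka kb kc] := all3; move: K; rewrite ka kb kc /=.
have N x s : is_classical (k x) ->
    over_side (k x) (~~ s) = ~~ over_side (k x) s.
  exact: over_sideN.
(* Only the crossing m of the middle and the bottom strand is recoloured: the
   middle strand crosses it on the other side of the top strand, which has the
   colour y t for each of its crossings t. *)
have slide m t : m \in [:: a; b; c] -> t \in [:: a; b; c] -> m != t ->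
    (forall y' : nat -> R, y' m = 2 * y t - y m ->
      (forall e, e != m -> y' e = y e) ->
      tangle_carries k y' T' (a1, a2, a3) (b1, b2, b3)) ->
  recolorable k [:: a; b; c] T T' y (a1, a2, a3) (b1, b2, b3).
  move=> mX tX mt ok; pose y' e := if e == m then 2 * y t - y m else y e.
  have y'm : y' m = 2 * y t - y m by rewrite /y' eqxx.
  have y'o e : e != m -> y' e = y e by rewrite /y' => /negPf ->.
  exists y'; split; [|exact: ok|].
    by move=> e eX; apply: y'o; apply: contraNneq eX => ->.
  move=> e _ _; rewrite !mono ka kb kc.
  move=> -[/(_ isT) ea /(_ isT) eb /(_ isT) ec].
  have y'X x : x \in [:: a; b; c] -> y' x = e.
    by rewrite !inE => /or3P[] /eqP ->.
  have yt : y t = e by rewrite -y'o 1?eq_sym // y'X.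
  have ym : y m = e.
    by have := y'm; rewrite y'X // yt => /reflection_fixed.
  have yX x : y' x = e -> y x = e.
    by have [->|/y'o <-] := eqVneq x m.
  by split=> _; apply: yX.
have ac : a != c by rewrite eq_sym.
have ba : b != a by rewrite eq_sym.
have cb : c != b by rewrite eq_sym.
case v12: (over_side (k a) s12); case v23: (over_side (k b) s23);
case v31: (over_side (k c) s31) => // _.
all: have := @along_over_eq R k y d1 (c, ~~ s31) (a, s12) a1 b1.
all: have := @along_over_eq R k y d2 (a, ~~ s12) (b, s23) a2 b2.
all: have := @along_over_eq R k y d3 (b, ~~ s23) (c, s31) a3 b3.
all: rewrite /= !N // v12 v23 v31 => e3 e2 e1.
all: move: (e1 kc ka) (e2 ka kb) (e3 kb kc) => {}e1 {}e2 {}e3.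
(* strand 1 over strand 2 over strand 3 *)
- have top := e1 isT isT H1.
  apply: (slide b a); rewrite ?inE ?eqxx ?orbT // => y' y'm y'o.
  split; [move: H1|move: H2|move: H3].
  + by apply: along_over_over; rewrite //= ?N ?v12 ?v31 ?y'o.
  + apply: along_sym => ? ? ?.
    by apply: along_over_under; rewrite //= ?N ?v12 ?v23 ?y'o.
  + apply: along_sym => ? ? ?.
    by apply: along_under_under; rewrite //= ?N ?v23 ?v31 ?y'm ?top ?y'o.
(* strand 3 over strand 1 over strand 2 *)
- have top := e3 isT isT H3.
  apply: (slide a b); rewrite ?inE ?eqxx ?orbT // => y' y'm y'o.
  split; [move: H1|move: H2|move: H3].
  + apply: along_sym => ? ? ?.
    by apply: along_over_under; rewrite //= ?N ?v12 ?v31 ?y'm ?top ?y'o.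
  + apply: along_sym => ? ? ?.
    by apply: along_under_under; rewrite //= ?N ?v12 ?v23 ?y'm ?y'o.
  + by apply: along_over_over; rewrite //= ?N ?v23 ?v31 ?y'o.
(* strand 1 over strand 3 over strand 2 *)
- have top := e1 isT isT H1.
  apply: (slide b a); rewrite ?inE ?eqxx ?orbT // => y' y'm y'o.
  split; [move: H1|move: H2|move: H3].
  + by apply: along_over_over; rewrite //= ?N ?v12 ?v31 ?y'o.
  + by apply: along_under_under; rewrite //= ?N ?v12 ?v23 ?y'm ?y'o.
  + by apply: along_over_under; rewrite //= ?N ?v23 ?v31 ?y'm ?top ?y'o.
(* strand 2 over strand 3 over strand 1 *)
- have top := e2 isT isT H2.
  apply: (slide c a); rewrite ?inE ?eqxx ?orbT // => y' y'm y'o.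
  split; [move: H1|move: H2|move: H3].
  + apply: along_sym => ? ? ?.
    by apply: along_under_under; rewrite //= ?N ?v12 ?v31 ?y'm ?y'o.
  + by apply: along_over_over; rewrite //= ?N ?v12 ?v23 ?y'o.
  + apply: along_sym => ? ? ?.
    by apply: along_over_under; rewrite //= ?N ?v23 ?v31 ?y'm ?top ?y'o.
(* strand 2 over strand 1 over strand 3 *)
- have top := e2 isT isT H2.
  apply: (slide c a); rewrite ?inE ?eqxx ?orbT // => y' y'm y'o.
  split; [move: H1|move: H2|move: H3].
  + by apply: along_over_under; rewrite //= ?N ?v12 ?v31 ?y'm ?y'o.
  + by apply: along_over_over; rewrite //= ?N ?v12 ?v23 ?y'o.
  + by apply: along_under_under; rewrite //= ?N ?v23 ?v31 ?y'm ?top ?y'o.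
(* strand 3 over strand 2 over strand 1 *)
- have top := e3 isT isT H3.
  apply: (slide a b); rewrite ?inE ?eqxx ?orbT // => y' y'm y'o.
  split; [move: H1|move: H2|move: H3].
  + by apply: along_under_under; rewrite //= ?N ?v12 ?v31 ?y'm ?top ?y'o.
  + by apply: along_over_under; rewrite //= ?N ?v12 ?v23 ?y'm ?y'o.
  + by apply: along_over_over; rewrite //= ?N ?v23 ?v31 ?y'o.
Qed.

Lemma refines_swap (R : comNzRingType) k X s1 s2 s3 t1 t2 t3 :
    refines R k X (s1, s2, s3) (t1, t2, t3) ->
  refines R k X (s1, s3, s2) (t1, t3, t2).
Proof.
move=> h y [[a1 a2] a3] [[b1 b2] b3] [/= c1 c3 c2].
have [|y' [off [/= d1 d2 d3] back]] := h y (a1, a3, a2) (b1, b3, b2).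
  by split.
exists y'; split=> // e [? ? ?] [? ? ?]; subst.
have := back e erefl erefl; rewrite /tangle_word /= !monochromatic_cat.
tauto.
Qed.

Lemma plug_uniq u v w z T :
  uniq (plug u v w z T) = uniq (tangle_word T ++ (u ++ v ++ w ++ z)).
Proof.
apply: perm_uniq; apply/permP => P; rewrite /plug /tangle_word !count_cat; lia.
Qed.

(** A crossing that has both its passages inside the tangle cannot occur
    outside, so its colour is free to change. *)
Lemma outside_labels (X : seq nat) T u v w z :
    {in X, forall x b, (x, b) \in tangle_word T} ->
    uniq (plug u v w z T) ->
  {in u ++ v ++ w ++ z, forall p, p.1 \notin X}.
Proof.
move=> hX; rewrite plug_uniq cat_uniq => /and3P[_ /hasPn h _] [x b] /h.
by apply: contra => /= /hX.
Qed.

Lemma colorable_plug (R : comNzRingType) k s X u v w z T T' :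
    {in X, forall x b, (x, b) \in tangle_word T} ->
    uniq (plug u v w z T) ->
    refines R k X T T' /\ refines R k X T' T ->
  colorable R (Prediagram (plug u v w z T) k s) <->
  colorable R (Prediagram (plug u v w z T') k s).
Proof.
move=> hX uT [TT' T'T]; have out := outside_labels hX uT.
by split; [apply: (colorable_refines out TT')
         | apply: (colorable_refines out T'T)].
Qed.

Lemma triangle_word_perm o1 o2 o3 a b c d1 d2 d3 :
  perm_eq (tangle_word (triangle o1 o2 o3 a b c d1 d2 d3))
    [:: (a, false); (a, true); (b, false); (b, true); (c, false); (c, true)].
Proof.
apply/permP => P; rewrite /tangle_word /triangle /strand1 /strand2 /strand3.
have alongE d p q : count P (along d p q) = (P p + P q)%N.
  by case: d; rewrite /= addn0 // addnC.
rewrite !count_cat !alongE /=.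
by move: (o1) (o2) (o3) => [] [] [] /=;
  move: (P (a, true) : nat) (P (a, false) : nat) (P (b, true) : nat)
        (P (b, false) : nat) (P (c, true) : nat) (P (c, false) : nat); lia.
Qed.

Lemma triangle_distinct o1 o2 o3 a b c d1 d2 d3 :
  uniq (tangle_word (triangle o1 o2 o3 a b c d1 d2 d3)) ->
  [/\ a != b, b != c & c != a].
Proof.
rewrite (perm_uniq (triangle_word_perm _ _ _ _ _ _ _ _ _)) => h.
by split; apply/eqP => E; move: h; rewrite E /= !inE !eqxx ?orbT ?andbF.
Qed.

Lemma triangle_labels o1 o2 o3 a b c d1 d2 d3 :
  {in [:: a; b; c], forall x e,
     (x, e) \in tangle_word (triangle o1 o2 o3 a b c d1 d2 d3)}.
Proof.
move=> x + e; rewrite (perm_mem (triangle_word_perm _ _ _ _ _ _ _ _ _)).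
by rewrite !inE => /or3P[] /eqP ->; case: e; rewrite eqxx ?orbT.
Qed.

Lemma refines_triangle_iff (R : comNzRingType) k o1 o2 o3 a b c :
    uniq (tangle_word (triangle o1 o2 o3 a b c o1 o2 o3)) ->
    R3_kinds o1 o2 o3 (k a) (k b) (k c) ->
  let T := triangle o1 o2 o3 a b c in
  refines R k [:: a; b; c] (T o1 o2 o3) (T (~~ o1) (~~ o2) (~~ o3)) /\
  refines R k [:: a; b; c] (T (~~ o1) (~~ o2) (~~ o3)) (T o1 o2 o3).
Proof.
move=> /triangle_distinct[ab bc ca] K T.
split; first exact: refines_triangle.
have := @refines_triangle R k o1 o2 o3 a b c (~~ o1) (~~ o2) (~~ o3).
by rewrite !negbK; apply.
Qed.

Lemma move_colorable (R : comNzRingType) D D' :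
    uniq (word D) -> uniq (word D') -> move D D' ->
  colorable R D <-> colorable R D'.
Proof.
move=> uD uD' m; case: m uD uD' => {D D'}.
- by move=> /= w k s f k' finj fk _ _; exact: colorable_relabel.
- by move=> p u q v k s s' _ _ _; split; apply: colorable_rot.
- move=> u v k s x b /= _ uT.
  have E T : u ++ T ++ v = plug u v [::] [::] (T, [::], [::]).
    by rewrite /plug /= cats0.
  rewrite (E [::]) -[_ :: _ :: v]/([:: _; _] ++ v) !E in uT *.
  apply: iff_sym; apply: (colorable_plug _ (X := [:: x])) => //.
    by move=> y; rewrite inE => /eqP -> []; case: (b); rewrite !inE eqxx ?orbT.
  exact: refines_twist.
- move=> u v w k s x y b d kxy /= _ uT.
  have E T1 T2 : u ++ T1 ++ v ++ T2 ++ w = plug u v w [::] (T1, T2, [::]).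
    by rewrite /plug /= cats0.
  rewrite (E [::] [::]) (E [:: _; _]) in uT *.
  apply: iff_sym; apply: (colorable_plug _ (X := [:: x; y])) => //.
    move=> z; rewrite !inE => /orP[] /eqP -> [];
    by case: (b) (d) => [] []; rewrite !inE !eqxx ?orbT.
  exact: refines_clasp.
- move=> u v w z k s o1 o2 o3 a b c K S1 S2 S3 /= uT _.
  have uW := uT; rewrite -[_ ++ _]/(plug u v w z (S1 o1, S2 o2, S3 o3)) in uW.
  apply: (@colorable_plug R k s [:: a; b; c] u v w z (S1 o1, S2 o2, S3 o3)
    (S1 (~~ o1), S2 (~~ o2), S3 (~~ o3)) _ uW).
    exact: triangle_labels.
  apply: refines_triangle_iff => //; move: uW.
  by rewrite plug_uniq cat_uniq => /and3P[].
- move=> u v w z k s o1 o2 o3 a b c K S1 S2 S3 /= uT _.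
  have uW := uT; rewrite -[_ ++ _]/(plug u v w z (S1 o1, S3 o3, S2 o2)) in uW.
  have swap d1 d2 d3 : perm_eq (tangle_word (S1 d1, S3 d3, S2 d2))
      (tangle_word (triangle o1 o2 o3 a b c d1 d2 d3)).
    by rewrite /tangle_word /= perm_cat2l perm_catC.
  have lab : {in [:: a; b; c], forall x e,
      (x, e) \in tangle_word (S1 o1, S3 o3, S2 o2)}.
    by move=> x xX e; rewrite (perm_mem (swap _ _ _)); exact: triangle_labels.
  apply: (@colorable_plug R k s [:: a; b; c] u v w z (S1 o1, S3 o3, S2 o2)
    (S1 (~~ o1), S3 (~~ o3), S2 (~~ o2)) lab uW).
  have [] := @refines_triangle_iff R k o1 o2 o3 a b c _ K.
    move: uW; rewrite plug_uniq cat_uniq => /and3P[+ _ _].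
    by rewrite (perm_uniq (swap _ _ _)).
  by move=> h1 h2; split; apply: refines_swap.
Qed.

Lemma equivalent_colorable (R : comNzRingType) (D D' : diagram) :
  virtually_equivalent D D' -> colorable R D <-> colorable R D'.
Proof.
have u (E : diagram) : uniq (word E).
  by case/andP: (diagram_valid E) => /andP[].
elim=> {D D'} [D D' /move_colorable->||D D' _ ->|D D' D'' _ -> _ ->] //.
Qed.

(** * Indices and chords *)

Lemma otherK : involutive other.
Proof. by case=> c b; rewrite /other /= negbK. Qed.

Lemma other_neq p : (other p == p) = false.
Proof. by case: p => c []; rewrite /other xpair_eqE eqxx. Qed.

Lemma word_from_rot D i p r :
  uniq (word D) -> rot i (word D) = p :: r -> word_from D p = p :: r.
Proof.
move=> uw; wlog iw : i / (i < size (word D))%N => [wl|] rotp.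
  have [iw|wi] := ltnP i (size (word D)); first exact: wl iw rotp.
  apply: (wl 0%N); last by rewrite rot0 -rotp rot_oversize.
  by rewrite -(size_rot i) rotp.
have ip : index p (word D) = i.
  have <- : nth p (word D) i = p; last by rewrite index_uniq.
  by move: rotp; rewrite /rot (drop_nth p) // => -[].
by rewrite /word_from ip.
Qed.

Definition over_weight D p : int :=
  if is_classical (kind D p.1) && is_over D p then sgn D p.1 else 0.

Definition linking_over D (A B : seq passage) : int :=
  \sum_(q <- A | other q \in B) over_weight D q.

Definition inner_over D (A : seq passage) : int :=
  \sum_(q <- A | (other q \in A) && (index q A < index (other q) A)%N)
    over_weight D q.

(** A passage q is met before its partner, on the way along A and then B,
    either because its partner lies on B, or because both lie on the same part
    in this order. The second contribution does not depend on whether A or B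
    comes first; this is why only linking numbers enter the indices. *)
Lemma label_chord D i p A B :
    double_points_ok (word D) ->
    rot i (word D) = p :: A ++ other p :: B ->
  label D p =
  over_weight D p + linking_over D A B + inner_over D A + inner_over D B.
Proof.
move=> /andP[uw /allP closed] rotp; set W := _ :: _ in rotp.
have uW : uniq W by rewrite -rotp rot_uniq.
have oW q : q \in W -> other q \in W.
  by rewrite -rotp !mem_rot; apply: closed.
rewrite /label /first_met_over (word_from_rot uw rotp) -/W big_map big_filter.
transitivity (\sum_(q <- W | (index q W < index (other q) W)%N)
    over_weight D q).
  rewrite [RHS]big_mkcond [LHS]big_mkcond; apply: eq_bigr => q _.
  rewrite /over_weight.
  by case: is_classical; case: is_over => /=; case: ifP.
have [[pA pB] [p'A p'B] /hasPn AB] :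
    [/\ p \notin A /\ p \notin B, other p \notin A /\ other p \notin B
      & ~~ has (mem A) B].
  move: uW; rewrite /W /= mem_cat inE !negb_or cat_uniq /= negb_or.
  by move=> /andP[/and3P[pA _ pB]] /and3P[_ /andP[? ?] /andP[? _]].
have AneqB q : q \in A -> q \in B = false.
  by move=> qA; apply: contraTF qA; exact: AB.
have iA q : q \in A -> index q W = (index q A).+1.
  move=> qA; rewrite /W /= index_cat qA; case: eqP => // pq.
  by rewrite pq qA in pA.
have iB q : q \in B -> index q W = (size A + (index q B).+1).+1.
  move=> qB; have qA : q \in A = false by apply: contraTF qB => /AneqB->.
  rewrite /W /= index_cat qA /=; case: eqP => [pq|_].
    by rewrite pq qB in pB.
  by case: eqP => // pq; rewrite pq qB in p'B.
have split_in q : q \in A \/ q \in B -> (other q \in A) || (other q \in B).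
  move=> qAB; have := oW q; rewrite !inE !mem_cat !inE.
  have qp : other q != p.
    apply: contraTneq isT => qp; move: p'A p'B; rewrite -qp otherK.
    by case: qAB => ->.
  have qp' : other q != other p.
    rewrite (inj_eq (can_inj otherK)).
    by apply: contraTneq isT => qp'; move: pA pB; rewrite -qp'; case: qAB => ->.
  by rewrite (negPf qp) (negPf qp') /=; apply; case: qAB => ->; rewrite !orbT.
have ltp : (index p W < index (other p) W)%N.
  by rewrite /W /= eqxx eq_sym other_neq.
have defW : W = p :: A ++ other p :: B by [].
move: W defW ltp iA iB {rotp uW oW} => W defW ltp iA iB.
rewrite {1}defW.
rewrite big_cons big_cat big_cons otherK ltp ltnNge (ltnW ltp).
rewrite -!addrA; congr (_ + _); rewrite addrA; congr (_ + _).
  rewrite big_mkcond /linking_over /inner_over [X in X + _]big_mkcond.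
  rewrite [X in _ + X]big_mkcond -big_split; apply: eq_big_seq => q qA.
  rewrite [RHS]/=.
  have /split_in : q \in A \/ q \in B by left.
  rewrite iA //; have [oA _|oA oB] := boolP (other q \in A).
    by rewrite iA // (AneqB _ oA) add0r.
  rewrite orFb in oB; rewrite iB // oB addr0 !ltnS.
  by rewrite (leq_trans (_ : index q A < size A)%N) ?index_mem // leq_addr.
rewrite /inner_over big_mkcond [RHS]big_mkcond; apply: eq_big_seq => q qB.
have /split_in : q \in A \/ q \in B by right.
have qA : q \in A = false by apply: contraTF qB => /AneqB->.
rewrite iB //; have [oA _|oA oB] := boolP (other q \in A).
  rewrite iA // (AneqB _ oA) !ltnS.
  rewrite ltnNge (leq_trans (_ : index (other q) A <= size A)%N) ?index_size //.
  exact: leq_addr.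
rewrite orFb in oB; rewrite iB // oB andTb.
by rewrite !ltnS ltn_add2l ltnS.
Qed.

(** The two labels at a chord differ by what its own crossing contributes,
    which is 1 for either sign, and by the difference of the two linking
    numbers of the arcs that the chord cuts off. *)
Lemma Ind_eq0 D i p A B :
    double_points_ok (word D) -> is_classical (kind D p.1) ->
    rot i (word D) = p :: A ++ other p :: B ->
    linking_over D A B = linking_over D B A ->
  Ind D p.1 = 0.
Proof.
move=> ok kp rotp AB.
have [j rotp'] : exists j,
    rot j (word D) = other p :: B ++ other (other p) :: A.
  exists (rot_add (word D) i (size (p :: A))).
  by rewrite otherK -rot_rot_add rotp -cat_cons rot_size_cat.
have lp := label_chord ok rotp; have lp' := label_chord ok rotp'.
have d : label D p - label D (other p) =
         over_weight D p - over_weight D (other p).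
  by rewrite lp lp' AB; ring.
have {lp lp'} d1 : label D (p.1, true) - label D (p.1, false) = 1.
  transitivity (over_weight D (p.1, true) - over_weight D (p.1, false)).
    case: (p) d => c [] //= d'.
    by rewrite -[RHS]opprB -d' opprB.
  rewrite /over_weight /is_over kp /sgn /=.
  by case: (kind D p.1) kp.
by rewrite /Ind d1 subrr mulr0.
Qed.

Lemma linking_over_closed D (A B : seq passage) :
    {in A, forall q, other q \in A} -> ~~ has (mem A) B ->
  linking_over D A B = 0.
Proof.
move=> cA /hasPn dis; rewrite /linking_over big_seq_cond big1 // => q.
by move=> /andP[/cA qA /dis/negP].
Qed.

(** * Smoothing a chord that all the others cross in parallel *)

(** The curve goes along X and then back along the same crossings. *)
Definition retraced X : seq passage := X ++ rev [seq other q | q <- X].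

Lemma retraced_closed X : {in retraced X, forall q, other q \in retraced X}.
Proof.
move=> q; rewrite !mem_cat !mem_rev => /orP[qX|/mapP[r rX ->]].
  by rewrite (map_f _ qX) orbT.
by rewrite otherK rX.
Qed.

(** The chords of a retraced curve are nested, so both arcs cut off by a chord
    contain the partners of all their passages. *)
Lemma Ind_retraced D i X p :
    uniq (word D) -> rot i (word D) = retraced X ->
    p \in word D -> is_classical (kind D p.1) ->
  Ind D p.1 = 0.
Proof.
move=> uw rotX pD kp.
have memw : word D =i retraced X by move=> q; rewrite -rotX mem_rot.
have ok : double_points_ok (word D).
  rewrite /double_points_ok uw; apply/allP => q; rewrite !memw.
  exact: retraced_closed.
wlog pX : p pD kp / p \in X.
  move=> wl; move: (pD); rewrite memw mem_cat mem_rev => /orP[|/mapP[q qX pq]].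
    exact: wl.
  rewrite pq /=; apply: (wl q) => //; first by rewrite memw mem_cat qX.
  by move: kp; rewrite pq.
move: pX rotX => /path.splitPr[X1 X2] rotX.
pose A := retraced X2; pose B := rev (retraced (rev X1)).
have rotp :
    rot (rot_add (word D) i (size X1)) (word D) = p :: A ++ other p :: B.
  rewrite -rot_rot_add rotX /retraced -catA rot_size_cat map_cat rev_cat /=.
  rewrite rev_cons /A /B /retraced rev_cat revK -!catA -cat_cons.
  by rewrite cat_rcons map_rev revK.
have cA : {in A, forall q, other q \in A} by apply: retraced_closed.
have cB : {in B, forall q, other q \in B}.
  by move=> q; rewrite !mem_rev; apply: retraced_closed.
have : uniq (p :: A ++ other p :: B) by rewrite -rotp rot_uniq.
rewrite cons_uniq cat_uniq /= negb_or => /andP[_ /and3P[_ /andP[_ AB] _]].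
apply: (Ind_eq0 ok kp rotp); rewrite !linking_over_closed //.
by rewrite has_sym.
Qed.

(** The predicate mixed is kept abstract: only its values at crossings of the
    word matter. *)
Lemma smooth_word D u p v q z :
    word D = u ++ p :: v ++ q :: z -> p.1 = q.1 ->
    p.1 \notin [seq x.1 | x <- u] -> p.1 \notin [seq x.1 | x <- v] ->
  exists mixed : pred nat,
    (forall d, mixed d = (((d, true) \in v) != ((d, false) \in v))) /\
    word (smooth p.1 D) = [seq (x.1, x.2 (+) mixed x.1)
      | x <- if is_over D p then rev z ++ v ++ rev u else u ++ rev v ++ z].
Proof.
move=> wD pq pu pv.
have findE s r t : r.1 = p.1 -> p.1 \notin [seq x.1 | x <- s] ->
    find (fun x : passage => x.1 == p.1) (s ++ r :: t) = size s.
  move=> rp ps; rewrite find_cat /= rp eqxx addn0; case: ifP => //.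
  by move=> /hasP[x xs /eqP xp]; rewrite -xp map_f in ps.
rewrite /smooth wD findE // nth_cat ltnn subnn /= take_size_cat //.
rewrite drop_cat ltnNge leqnSn /= subSn // subnn /= drop0 findE //.
rewrite take_size_cat // drop_cat ltnNge leqnSn /= subSn // subnn /= drop0.
by eexists; split=> //.
Qed.

(** Reversing one side of the chord turns two parallel runs through the other
    crossings into a run and its reverse; each of these crossings has exactly
    one strand on the reversed side, hence is turned. *)
Lemma smooth_parallel D u p v z :
    double_points_ok (word D) ->
    word D = u ++ p :: v ++ other p :: z ->
    z ++ u = [seq other q | q <- v] ->
  forall c, c \in crossings (smooth p.1 D) -> Ind (smooth p.1 D) c = 0.
Proof.
move=> /andP[uw _] wD zuv.
have upvz : uniq (p :: other p :: v ++ z ++ u).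
  have : uniq (u ++ p :: v ++ other p :: z) by rewrite -wD.
  rewrite (perm_uniq (_ : perm_eq _ (p :: other p :: v ++ z ++ u))) //.
  by apply/permP => P; rewrite /= !count_cat /= !count_cat /=; lia.
have [pv pzu] : p.1 \notin [seq x.1 | x <- v] /\
    p.1 \notin [seq x.1 | x <- z ++ u].
  have -> : [seq x.1 | x <- z ++ u] = [seq x.1 | x <- v].
    by rewrite zuv -map_comp.
  suff : p.1 \notin [seq x.1 | x <- v] by [].
  apply/negP => /mapP[[d b] dv /= pd]; move: upvz => /= .
  rewrite !inE !mem_cat !negb_or; case: (p) pd dv => [e b'] /= -> dv.
  by case: (b) (b') dv => [] [] ->; rewrite ?andbF.
have uv : uniq (v ++ z ++ u) by move: upvz => /= /and3P[].
have pu : p.1 \notin [seq x.1 | x <- u].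
  by apply: contra pzu; rewrite map_cat mem_cat => ->; rewrite orbT.
have [mixed [mixedE wS]] := smooth_word wD erefl pu pv.
have all_mixed q : q \in v ++ z ++ u -> mixed q.1.
  have in_v r : r \in v -> mixed r.1.
    move=> rv; have : other r \notin v.
      move: uv; rewrite zuv cat_uniq => /and3P[_ /hasPn h _].
      by apply: h; apply: map_f.
    by rewrite mixedE; case: r rv => e []; rewrite /other /= => -> /negPf ->.
  rewrite zuv mem_cat => /orP[/in_v//|/mapP[r rv ->]]; exact: (in_v r).
have {}wS : word (smooth p.1 D) = [seq other x
      | x <- if is_over D p then rev z ++ v ++ rev u else u ++ rev v ++ z].
  rewrite wS; apply/eq_in_map => q qS.
  rewrite all_mixed ?addbT //; move: qS.
  by case: ifP => _; rewrite !mem_cat ?mem_rev => /or3P[] ->; rewrite ?orbT.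
have uS : uniq (word (smooth p.1 D)).
  rewrite wS (map_inj_uniq (can_inj otherK)).
  rewrite (perm_uniq (_ : perm_eq _ (v ++ z ++ u))) //.
  by apply/permP => P; case: ifP => _; rewrite !count_cat ?count_rev; lia.
have [i [X rotX]] : exists i X, rot i (word (smooth p.1 D)) = retraced X.
  rewrite wS; case: ifP => _.
    exists (size z), [seq other x | x <- v].
    rewrite -(size_rev z) -map_rot rot_size_cat -catA -rev_cat zuv.
    by rewrite /retraced map_cat map_rev.
  exists (size u), [seq other x | x <- rev v].
  rewrite -map_rot rot_size_cat -catA zuv /retraced map_cat.
  by rewrite -map_rev -!map_rev revK.
move=> c /mapP[q]; rewrite mem_filter => /andP[/andP[_ kq] qS] ->.
exact: Ind_retraced uS rotX qS kq.
Qed.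

(** * The standard diagrams of the torus knots T(2,n) *)

Local Open Scope nat_scope.

(** The curve runs twice through a braid with two strands and n crossings, and
    comes in alternately on the right (even i) and on the left. *)
Definition torus_pass (n i : nat) : passage := (i %% n, odd i)%N.

Definition torus_word n : seq passage :=
  [seq torus_pass n i | i <- iota 0 n.*2].

Definition torus n : prediagram :=
  Prediagram (torus_word n) (fun=> Positive) true.

Lemma torus_passD n i : odd n -> torus_pass n (i + n) = other (torus_pass n i).
Proof. by move=> on; rewrite /torus_pass modnDr oddD on addbT. Qed.

Lemma torus_passMD n i m : torus_pass n (i + m * n.*2) = torus_pass n i.
Proof.
by rewrite /torus_pass addnC -mul2n mulnA modnMDl oddD !oddM andbF.
Qed.

Lemma torus_pass_mod n i : torus_pass n (i %% n.*2) = torus_pass n i.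
Proof. by rewrite [i in RHS](divn_eq i n.*2) addnC torus_passMD. Qed.

Lemma torus_pass_inj n i j : odd n -> i < n.*2 -> j < n.*2 ->
  torus_pass n i = torus_pass n j -> i = j.
Proof.
move=> on; wlog ij : i j / i <= j => [wl i2 j2 e|i2 j2 [eqm eqo]].
  by case/orP: (leq_total i j) => ?; [|apply: esym]; apply: wl.
have /dvdnP[m mE] : n.*2 %| j - i.
  rewrite -mul2n Gauss_dvd ?coprime2n // -(@eqn_mod_dvd n) // eqm eqxx andbT.
  by rewrite dvdn2 oddB // eqo addbb.
case: m mE => [|m] mE; first by lia.
by have := leq_trans (leq_addr (m * n.*2) n.*2) (leqnn _); lia.
Qed.

Lemma torus_uniq n : odd n -> uniq (torus_word n).
Proof.
move=> on; rewrite map_inj_in_uniq ?iota_uniq // => i j.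
by rewrite !mem_iota !add0n /= => ? ?; apply: torus_pass_inj.
Qed.

Lemma mem_torus n i : 0 < n -> torus_pass n i \in torus_word n.
Proof.
move=> n0; rewrite -torus_pass_mod; apply: map_f.
by rewrite mem_iota ltn_mod double_gt0.
Qed.

Lemma torus_wordP n p : p \in torus_word n -> exists i, p = torus_pass n i.
Proof. by case/mapP => i _ ->; exists i. Qed.

Lemma torus_ok n : odd n -> double_points_ok (torus_word n).
Proof.
move=> on; rewrite /double_points_ok torus_uniq //; apply/allP => p.
by move=> /torus_wordP[i ->]; rewrite -torus_passD // mem_torus // odd_gt0.
Qed.

Lemma torus_rot n i : i <= n.*2 ->
  rot i (torus_word n) = [seq torus_pass n j | j <- iota i n.*2].
Proof.
move=> i2; rewrite /torus_word -map_rot -{1}(subnKC i2) iotaD add0n.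
rewrite -{1}(size_iota 0 i) rot_size_cat.
rewrite -[in RHS](subnK i2) iotaD subnKC // !map_cat; congr (_ ++ _).
rewrite -[n.*2 in RHS]addn0 iotaDl -map_comp; apply: eq_map => j /=.
by rewrite addnC -[n.*2 in RHS]mul1n torus_passMD.
Qed.

Lemma torus_next n i : odd n ->
  next (torus_word n) (torus_pass n i) = torus_pass n i.+1.
Proof.
move=> on; have n0 := odd_gt0 on.
have -> : torus_pass n i.+1 = torus_pass n (i %% n.*2).+1.
  by rewrite -torus_pass_mod -addn1 -modnDml addn1 torus_pass_mod.
rewrite -(torus_pass_mod n i).
have : i %% n.*2 < n.*2 by rewrite ltn_mod double_gt0.
move: (i %% n.*2) => {}i i2.
rewrite -(next_rot i (torus_uniq on)) torus_rot; last exact: ltnW.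
by case: n n0 {on i2} => // n _; rewrite doubleS /= eqxx.
Qed.

Lemma torus_prev n i : odd n ->
  prev (torus_word n) (torus_pass n i.+1) = torus_pass n i.
Proof. by move=> on; rewrite -torus_next // prev_next // torus_uniq. Qed.

Lemma torus_face_step n i d : odd n ->
  face_step (torus_word n) (torus_pass n i.+1, d) =
  if odd i.+1 == d then (torus_pass n (i.+1 + n), ~~ d)
  else (torus_pass n (if d then (i.+1 + n).+1 else (i + n)), d).
Proof.
move=> on; rewrite /face_step; case: d => /=.
  rewrite torus_next //= negbK -torus_passD // addSn torus_prev //.
  by case: (odd i).
rewrite -torus_passD // addSn torus_prev //.
by case: (odd i).
Qed.

(** The bigon above the crossing c is bounded by the edge that leaves c at the
    top right, walked along the orientation, and by the edge that leaves c at
    the top left, walked backwards; it gets the number c + 2. All the other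
    darts bound the regions on the left and on the right of the braid, with
    the numbers 1 and 0. *)
Definition torus_face (x : dart) : nat :=
  if x.1.2 == x.2 then x.1.1.+2 else x.2.

Lemma torus_passS n i : odd n ->
  exists j, torus_pass n i = torus_pass n j.+1 /\ i + n.*2 = j.+1.
Proof.
move=> on; exists (i + n.*2).-1; have n0 := odd_gt0 on.
have i2 : (i + n.*2).-1.+1 = i + 1 * n.*2 by lia.
by rewrite i2 torus_passMD mul1n.
Qed.

Lemma eq_torus_pass n i j :
  i = j %[mod n.*2] -> torus_pass n i = torus_pass n j.
Proof. by move=> ij; rewrite -torus_pass_mod ij torus_pass_mod. Qed.

Lemma shift_mod N a b : 0 < N -> exists2 k, k < N & a + k = b %[mod N].
Proof.
move=> N0; exists ((b + (N - a %% N)) %% N); first by rewrite ltn_mod.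
have aN : a %% N < N by rewrite ltn_mod.
rewrite modnDmr (_ : a + _ = (a %/ N).+1 * N + b) ?modnMDl //.
by rewrite {1}(divn_eq a N) mulSn; lia.
Qed.

Lemma torus_dartP n x : odd n ->
  x \in darts (torus_word n) -> exists i, x = (torus_pass n i.+1, x.2).
Proof.
move=> on; rewrite mem_cat => /orP[] /mapP[p /mapP[i _ ->] ->] /=;
by case: (torus_passS i on) => j [-> _]; exists j.
Qed.

Lemma mem_torus_darts n i d :
  0 < n -> (torus_pass n i, d) \in darts (torus_word n).
Proof.
move=> n0; rewrite mem_cat; apply/orP.
by case: d; [left|right]; rewrite (map_f (fun p => (p, _))) // mem_torus.
Qed.

Lemma torus_face_step_class n i d : odd n ->
  torus_face (face_step (torus_word n) (torus_pass n i.+1, d)) =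
  torus_face (torus_pass n i.+1, d).
Proof.
move=> on; rewrite torus_face_step //.
case: (eqVneq (odd i.+1) d) => [<-|oid].
  by rewrite /torus_face /= oddD on addbT !eqxx modnDr.
rewrite /torus_face /= (negPf oid); case: ifP => // /eqP.
by move: oid; case: d; rewrite /= ?oddD on addbT; case: (odd i).
Qed.

(** Around the left or the right region, the walk moves by n + 1 or by n - 1
    places along the curve. *)
Lemma iter_face_step n d i k : odd n -> odd i != d ->
  iter k (face_step (torus_word n)) (torus_pass n i, d) =
  (torus_pass n (i + k * (if d then n.+1 else n.-1)), d).
Proof.
move=> on oid; have n0 := odd_gt0 on; elim: k => [|k IH] /=.
  by rewrite addn0.
rewrite IH; set j := i + _.
have oj : odd j != d.
  have -> : odd j = odd i; last by [].
  rewrite /j oddD oddM (_ : odd (if d then _ else _) = false) ?andbF ?addbF //.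
  by case: (d); rewrite /= ?on //; case: (n) on => //= m /negbTE.
have [j' [-> jj']] := torus_passS j on.
rewrite torus_face_step // -jj' oddD odd_double addbF (negPf oj); congr (_, _).
have {jj'} -> : j' = (j + n.*2).-1 by lia.
case: (d) @j {oj oid IH} => j.
  rewrite (_ : _.+1 = i + k.+1 * n.+1 + 1 * n.*2) ?torus_passMD // /j; lia.
rewrite (_ : _ + n = i + k.+1 * n.-1 + 1 * n.*2) ?torus_passMD // /j.
by case: (n) n0 => // m _ /=; lia.
Qed.

(** On the two long faces, multiples of n + 1 or of n - 1 must reach every
    even residue modulo 2 n: for an even number k of steps, they are k or - k
    modulo 2 n. *)
Lemma torus_orbit n x y : odd n ->
    x \in darts (torus_word n) -> y \in darts (torus_word n) ->
  (y \in face_orbit (torus_word n) x) = (torus_face y == torus_face x).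
Proof.
move=> on xD yD; have n0 := odd_gt0 on.
set f := face_step (torus_word n).
have szD : size (darts (torus_word n)) = (n.*2).*2.
  by rewrite size_cat !size_map size_iota addnn.
apply/idP/eqP => [/trajectP[k _ ->]|].
  have : exists i d, iter k f x = (torus_pass n i.+1, d) /\
     torus_face (torus_pass n i.+1, d) = torus_face x.
    elim: k => [|k [i [d [E IH]]]] /=.
      by have [i xE] := torus_dartP on xD; exists i, x.2; rewrite -xE.
    rewrite E -IH; set z := f _.
    have [|j jE] := torus_dartP (x := z) on.
      rewrite /z /f torus_face_step //; case: ifP => _; exact: mem_torus_darts.
    by exists j, z.2; rewrite -jE torus_face_step_class.
  by case=> i [d [-> ->]].
move=> xy; apply/trajectP; rewrite szD.
case: (torus_dartP on xD) => i xE; case: (torus_dartP on yD) => j yE.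
move: xy; rewrite {}xE {}yE {xD yD}; move: x.2 y.2 => d e {x y}.
rewrite /torus_face.
have [oj|oj] := eqVneq (torus_pass n j.+1).2 e;
  have [oi|oi] := eqVneq (torus_pass n i.+1).2 d.
- move: oi oj => /= oi oj [jin]; have [de|de] := eqVneq d e.
    by exists 0; rewrite ?double_gt0 //= /torus_pass /= jin oj oi de.
  exists 1; first by lia.
  rewrite /= /f torus_face_step //= oi eqxx /torus_pass modnDr oddD on.
  by rewrite addbT jin /= oj oi; case: (d) (e) de => [] [].
- by case: (d).
- by case: (e).
move=> /= de; have {}de : e = d by case: (d) (e) de => [] [].
rewrite {}de in oj *; move: oi oj => /= oi oj.
have oij : odd i = odd j by case: (d) (odd i) (odd j) oi oj => [] [] [].
have even_k a b k : odd a = odd b -> a + k = b %[mod n.*2] ->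
    exists m, k = m.*2.
  move=> oab abk; exists k./2; apply/esym/even_halfK.
  have := congr1 odd abk; rewrite !odd_mod ?odd_double // oddD oab.
  by case: (odd b) (odd k) => [] [].
have [k k2 kE] : exists2 k, k < n.*2 &
    torus_pass n (i.+1 + k * (if d then n.+1 else n.-1)) = torus_pass n j.+1.
  have n20 : 0 < n.*2 by rewrite double_gt0.
  case: (d).
    have [k k2 kE] := shift_mod i.+1 j.+1 n20; exists k => //.
    have [|m km] := even_k _ _ _ _ kE; first by rewrite /= oij.
    rewrite -(eq_torus_pass kE).
    rewrite (_ : _ + _ = i.+1 + k + m * n.*2) ?torus_passMD //.
    by rewrite km; lia.
  have [k k2 kE] := shift_mod j.+1 i.+1 n20; exists k => //.
  have [|m km] := even_k _ _ _ _ kE; first by rewrite /= oij.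
  apply: eq_torus_pass; rewrite -modnDml -kE modnDml.
  rewrite (_ : _ + _ = m * n.*2 + j.+1) ?modnMDl // km.
  by case: (n) n0 => // l _ /=; lia.
exists k; first by lia.
by rewrite iter_face_step // kE.
Qed.

Lemma torus_planar n : odd n -> planar (torus_word n).
Proof.
move=> on; have n0 := odd_gt0 on; apply/orP; right.
set D := darts (torus_word n).
pose h c := [seq y <- D | torus_face y == c].
have -> : faces (torus_word n) = undup (map h (map torus_face D)).
  rewrite /faces -map_comp; congr undup; apply/eq_in_map => x xD.
  by apply: eq_in_filter => y yD; rewrite /= torus_orbit.
have classes : map torus_face D =i iota 0 (n + 2).
  move=> c; rewrite mem_iota add0n /=; apply/mapP/idP => [[x xD ->]|].
    have [i ->] := torus_dartP on xD; rewrite /torus_face /=.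
    have := ltn_pmod i.+1 n0; case: ifP => _; case: x.2; lia.
  case: c => [|[|c]] cn.
  - by exists (torus_pass n 1, false); rewrite ?mem_torus_darts.
  - by exists (torus_pass n 0, true); rewrite ?mem_torus_darts.
  exists (torus_pass n c, odd c); rewrite ?mem_torus_darts // /torus_face /=.
  by rewrite eqxx modn_small //; lia.
rewrite (perm_size (_ : perm_eq _ (map h (iota 0 (n + 2))))).
  by rewrite !size_map !size_iota doubleK.
apply: uniq_perm => [||z]; rewrite ?undup_uniq //; last first.
  by rewrite mem_undup; apply: eq_mem_map.
rewrite map_inj_in_uniq ?iota_uniq // => c c'.
rewrite -!classes => /mapP[x xD ->] _ hE.
have : x \in h (torus_face x) by rewrite mem_filter eqxx.
by rewrite hE mem_filter => /andP[/eqP].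
Qed.

Lemma torus_valid n : odd n -> valid (torus n).
Proof. by move=> on; rewrite /valid torus_ok // torus_planar. Qed.

Local Open Scope ring_scope.

(** * Colourings of the torus knots *)

(** A j is the colour of the arc that comes in at the passage j. *)
Lemma torus_carriesP (R : comNzRingType) n (y : nat -> R) i m a b :
  carries (fun=> Positive) y [seq torus_pass n j | j <- iota i m] a b <->
  exists A : nat -> R, [/\ A i = a, A (i + m)%N = b &
    forall j, (i <= j < i + m)%N ->
      if odd j then y (j %% n)%N = A j /\ A j.+1 = A j
      else A j.+1 = 2 * y (j %% n)%N - A j].
Proof.
elim: m i a => [|m IH] i a /=.
  split=> [->|[A [<- <- _]]]; last by rewrite addn0.
  by exists (fun=> b); split=> // j; rewrite addn0 ltnNge andbN.
pose c := if odd i then a else 2 * y (i %% n)%N - a.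
transitivity ((odd i -> y (i %% n)%N = a) /\
  carries (fun=> Positive) y [seq torus_pass n j | j <- iota i.+1 m] c b).
  rewrite /c; case: (odd i); split=> [|[]] //; first by case.
  by move=> /(_ isT).
rewrite IH addnS addSn; split=> [[yi [A [Ai Ab step]]]|[A [Ai Ab step]]].
  exists (fun j => if j == i then a else A j); split=> [||j jm].
  - by rewrite eqxx.
  - by rewrite gtn_eqF // ltnS leq_addr.
  rewrite [j.+1 == i]gtn_eqF; last by case/andP: jm.
  case: (eqVneq j i) => [->|ij].
    by rewrite Ai /c; case: odd yi => // ->.
  by apply: step; lia.
split.
  have := step i; rewrite leqnn ltnS leq_addr Ai => /(_ isT).
  by case: odd => // -[].
exists A; split=> // [|j jm]; last by apply: step; lia.
have := step i; rewrite leqnn ltnS leq_addr Ai => /(_ isT) {step}.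
by rewrite /c; case: odd => // -[].
Qed.

(** Before the crossing j, the left strand has the colour j, and the right
    strand the colour j - 1; this closes up modulo p. *)
Lemma torus_colorable p : prime p -> odd p -> colorable 'F_p (torus p).
Proof.
move=> pr_p odd_p; exists (fun c => c%:R), (-1); split; last first.
  move=> /(_ (torus_pass p 0)) /= h.
  have : (0 : 'F_p) = -1.
    rewrite -h // ?mod0n //; apply: map_f; rewrite mem_iota double_gt0.
    exact: prime_gt0.
  by move/eqP; rewrite eq_sym oppr_eq0 oner_eq0.
have natp := pchar_Fp pr_p.
apply/torus_carriesP; exists (fun j => if odd j then j%:R else j%:R - 1).
split=> [||j _] /=; first by rewrite sub0r.
  by rewrite add0n odd_double -addnn natrD (pcharf0 natp) addr0 sub0r.
rewrite Fp_nat_mod //.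
by case: odd => /=; rewrite -natr1; [split=> //|]; ring.
Qed.

(** The overstrand at the crossing j passes under the crossing j + 1 and
    becomes the overstrand at the crossing j + 2, so that the colours of the
    overstrands form an arithmetic progression; it has period n, so n times
    its difference is 0. *)
Lemma torus_not_colorable (R : comNzRingType) n :
    odd n -> (forall x : R, n%:R * x = 0 -> x = 0) ->
  ~ colorable R (torus n).
Proof.
move=> odd_n reg [y [a [/torus_carriesP[A [A0 An step]]]]]; apply.
pose B j := y (j %% n)%N.
have n_gt0 : (0 < n)%N by case: n odd_n {step An reg B}.
have Bper j : B (j + n)%N = B j by rewrite /B modnDr.
have over j : odd j -> (j < n.*2)%N -> A j = B j /\ A j.+1 = B j.
  by move=> oj jn; have := step j; rewrite oj add0n jn => /(_ isT)[<- ->].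
have under j : ~~ odd j -> (j.+2 < n.*2)%N -> B j.+3 = 2 * B j.+2 - B j.+1.
  move=> ej jn; have := step j.+2; rewrite /= negbK (negPf ej) add0n jn.
  move=> /(_ isT); rewrite (over j.+1 _ _).2 //=; last by lia.
  by rewrite (over j.+3 _ _).1 //= ?ej //; lia.
have arith j : (j.+1 < n)%N -> B j.+2 = 2 * B j.+1 - B j.
  move=> jn; have [oj|ej] := boolP (odd j).
    case: j oj jn => // j ej jn; apply: under => //; lia.
  rewrite -Bper -(Bper j.+1) -(Bper j).
  have [i ij] : exists i, (j + n = i.+1)%N by exists (j + n).-1; lia.
  rewrite 2!addSn ij; apply: under; last by lia.
  by move: ij; move: odd_n ej; lia.
have lin j : (j <= n)%N -> B j = B 0%N + j%:R * (B 1%N - B 0%N).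
  elim/ltn_ind: j => -[|[|j]] IH jn; first by ring.
    by ring.
  rewrite arith // IH ?(IH j) //; try lia.
  by rewrite -[j.+2]addn2 -[j.+1]addn1 !natrD; ring.
have d0 : B 1%N - B 0%N = 0.
  apply: reg; have := lin n (leqnn n).
  rewrite -{1}[n]add0n Bper => /(congr1 (fun x => x - B 0%N)).
  by rewrite subrr addrAC subrr add0r.
have Bc j : B j = B 0%N.
  have : (j %% n < n)%N by rewrite ltn_mod.
  by move=> /ltnW/lin; rewrite d0 mulr0 addr0 /B modn_mod.
have -> : a = B 0%N.
  rewrite -An add0n; have [i En] : exists i, n.*2 = i.+1 by exists n.*2.-1; lia.
  by rewrite En (over i _ _).2 //; lia.
by move=> _ /mapP[j _ ->] _; apply: (Bc j).
Qed.

(** * Vanishing of the F-polynomials *)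

Lemma dwrithe_eq0 D m :
    {in crossings D, forall c, Ind D c = 0} -> (0 < m)%N -> dwrithe m D = 0.
Proof.
move=> ind0 m0; rewrite /dwrithe.
have h (n : int) : n != 0 -> writhe n D = 0.
  move=> n0; rewrite /writhe big_seq_cond big_pred0 // => c.
  apply/andP => -[/ind0 -> /eqP n0']; by rewrite -n0' eqxx in n0.
by rewrite !h ?subrr // ?oppr_eq0 -lt0n.
Qed.

(** All the exponents are 0, and every crossing lies in T_n. *)
Lemma F_diagram_eq0 m D :
    (0 < m)%N -> {in crossings D, forall c, Ind D c = 0} ->
    (forall c, c \in crossings D ->
      {in crossings (smooth c D), forall d, Ind (smooth c D) d = 0}) ->
  F_diagram m D = 0.
Proof.
move=> m0 ind0 sind0; rewrite /F_diagram.
have dw c : c \in crossings D -> dwrithe m (smooth c D) = 0.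
  by move=> cD; apply: dwrithe_eq0 => //; apply: sind0.
have T c : c \in crossings D -> in_T m D c.
  by move=> cD; rewrite /in_T dw // dwrithe_eq0.
rewrite [X in _ - X]big_seq_cond [X in _ - X]big_pred0 ?subr0; last first.
  by move=> c; apply/andP => -[/T->].
rewrite [X in _ - X]big_mkcond -sumrB big_seq big1 // => c cD.
by rewrite T // dw // ind0 // !expr0z mulr1 subrr.
Qed.

(** The chord at c is crossed by all the other chords in parallel: the second
    run from c meets the crossings of v again in the same order. *)
Lemma torus_cut n c : odd n -> (c < n)%N ->
  exists u v z, [/\ torus_word n =
      u ++ torus_pass n c :: v ++ other (torus_pass n c) :: z,
    z ++ u = [seq other q | q <- v]
  & v = [seq torus_pass n i | i <- iota c.+1 n.-1]].
Proof.
move=> on cn; have n0 := odd_gt0 on.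
exists [seq torus_pass n i | i <- iota 0 c].
exists [seq torus_pass n i | i <- iota c.+1 n.-1].
exists [seq torus_pass n i | i <- iota (c + n).+1 (n - c.+1)]; split=> //.
  rewrite -torus_passD // /torus_word.
  have -> : n.*2 = (c + (1 + (n.-1 + (1 + (n - c.+1)))))%N by lia.
  have cn1 : (c.+1 + n.-1 = c + n)%N by lia.
  by rewrite !iotaD !map_cat /= add0n !addn1 cn1.
rewrite -map_comp.
have -> : [seq torus_pass n i | i <- iota 0 c] =
          [seq torus_pass n i | i <- iota n.*2 c].
  rewrite -[n.*2 in RHS]addn0 iotaDl -map_comp; apply: eq_map => i /=.
  by rewrite addnC -[n.*2]mul1n torus_passMD.
rewrite -map_cat.
have -> : iota (c + n).+1 (n - c.+1) ++ iota n.*2 c =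
          map (addn n) (iota c.+1 n.-1).
  rewrite -iotaDl (_ : n.-1 = (n - c.+1) + c)%N ?iotaD; last by lia.
  by congr (iota _ _ ++ iota _ _); lia.
by rewrite -map_comp; apply: eq_map => i /=; rewrite addnC torus_passD.
Qed.

Lemma torus_over_weight n p : over_weight (torus n) p = p.2.
Proof. by case: p => c []. Qed.

Lemma sum_odd m i :
  (\sum_(j <- iota i m.*2) (odd j : nat) =
   \sum_(j <- iota i m.*2) (~~ odd j : nat))%N.
Proof.
elim: m i => [|m IH] i; first by rewrite !big_nil.
rewrite doubleS /= !big_cons IH !addnA /= negbK.
by case: odd.
Qed.

Lemma torus_crossings n c : odd n -> c \in crossings (torus n) -> (c < n)%N.
Proof.
move=> on /mapP[p]; rewrite mem_filter => /andP[_ /torus_wordP[i ->] ->].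
by rewrite ltn_mod odd_gt0.
Qed.

Lemma torus_Ind n c : odd n -> c \in crossings (torus n) -> Ind (torus n) c = 0.
Proof.
move=> on cD; have cn := torus_crossings on cD.
have [u [v [z [wE zuv vE]]]] := torus_cut on cn.
rewrite (_ : c = (torus_pass n c).1); last by rewrite /= modn_small.
apply: (@Ind_eq0 _ (size u) _ v (z ++ u)); first exact: torus_ok.
- by [].
- by rewrite /= wE rot_size_cat -cat_cons -catA.
rewrite /linking_over zuv big_map.
have -> : \sum_(q <- v | other q \in [seq other q | q <- v])
    over_weight (torus n) q = \sum_(q <- v) (q.2 : nat)%:Z.
  rewrite [LHS]big_seq_cond [RHS]big_seq; apply: eq_big => q; last first.
    by rewrite torus_over_weight.
  by case qv: (q \in v); rewrite // map_f.
have -> : \sum_(q <- v | other (other q) \in v)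
    over_weight (torus n) (other q) = \sum_(q <- v) (~~ q.2 : nat)%:Z.
  rewrite [LHS]big_seq_cond [RHS]big_seq; apply: eq_big => q; last first.
    by rewrite torus_over_weight.
  by rewrite otherK andbb.
rewrite vE !big_map /=.
have [m ->] : exists m, n.-1 = m.*2.
  exists n.-1./2; rewrite even_halfK //; by case: (n) on.
have := sum_odd m c.+1 => /(congr1 Posz).
by rewrite !(big_morph Posz PoszD erefl).
Qed.

Lemma torus_smooth_Ind n c : odd n -> c \in crossings (torus n) ->
  {in crossings (smooth c (torus n)), forall d, Ind (smooth c (torus n)) d = 0}.
Proof.
move=> on cD d dS; have cn := torus_crossings on cD.
have [u [v [z [wE zuv vE]]]] := torus_cut on cn.
have cE : c = (torus_pass n c).1 by rewrite /= modn_small.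
rewrite cE in dS *.
exact: (smooth_parallel (D := torus n) (torus_ok on) wE zuv dS).
Qed.

(** * The family *)

Definition torus_knot_diagram n (on : odd n) : diagram :=
  Diagram (torus_valid on).

Definition knot_of (D : diagram) : virtual_knot :=
  VirtualKnot (ex_intro _ D erefl).

Lemma knot_of_inj D D' : knot_of D = knot_of D' -> virtually_equivalent D D'.
Proof.
move=> /(congr1 diagrams_of) /= E.
have : virtually_equivalent D' D' by apply: rst_refl.
by rewrite -E.
Qed.

Lemma odd_doubleS m : odd m.*2.+1.
Proof. by rewrite /= odd_double. Qed.

(** Indexing by half of n - 1 makes n odd without a hypothesis. *)
Definition torus_knot m : virtual_knot :=
  knot_of (torus_knot_diagram (odd_doubleS m)).

Lemma torus_knot_inj m m' : prime m.*2.+1 -> prime m'.*2.+1 ->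
  torus_knot m = torus_knot m' -> m = m'.
Proof.
move=> pr pr' /knot_of_inj /(equivalent_colorable 'F_m.*2.+1) /= eqv.
apply/eqP/negP => mm'.
apply: (torus_not_colorable (R := 'F_m.*2.+1) (odd_doubleS m') _); last first.
  by apply/eqv; apply: torus_colorable => //; exact: odd_doubleS.
move=> x /eqP; rewrite mulf_eq0 => /orP[|/eqP//].
rewrite -(dvdn_pcharf (pchar_Fp pr)) dvdn_prime2 // => /eqP[] /double_inj mE.
by rewrite mE eqxx in mm'.
Qed.

Lemma infinite_odd_primes : infinite_set [set m : nat | prime m.*2.+1]%classic.
Proof.
move=> /finite_seqP[s sE].
have [p ps pr_p] := prime_above (\max_(m <- s) m).*2.+2.
have odd_p : odd p by case/even_prime: pr_p ps => // ->.
have pE : p = p./2.*2.+1 by rewrite -[LHS]odd_double_half odd_p.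
have : [set` s]%classic p./2 by rewrite -sE /= -pE.
move=> /= ms; have m_le : (p./2 <= \max_(m <- s) m)%N.
  exact: leq_bigmax_seq ms _.
by move: ps; rewrite pE; lia.
Qed.

Theorem proposition3p2 :
  exists KK : set virtual_knot,
    infinite_set KK /\
    forall K K' : virtual_knot, KK K -> KK K' ->
      exists P : nat -> ratfun, F_polynomials K P /\ F_polynomials K' P.
Proof.
exists (torus_knot @` [set m | prime m.*2.+1])%classic; split.
  have inj : {in [set m | prime m.*2.+1]%classic &, injective torus_knot}.
    by move=> m m'; rewrite !inE; exact: torus_knot_inj.
  by rewrite (eq_finite_set (inj_card_eq inj)); exact: infinite_odd_primes.
move=> K K' [m _ <-] [m' _ <-]; exists (fun=> 0).
have F0 i : F_polynomials (torus_knot i) (fun=> 0).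
  exists (torus_knot_diagram (odd_doubleS i)); first exact: rst_refl.
  move=> n n0; apply: F_diagram_eq0 => // c cD.
    exact: (torus_Ind (odd_doubleS i)) cD.
  exact: (torus_smooth_Ind (odd_doubleS i)) cD.
by split.
Qed.
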